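(* Consider the one-dimensional Maxwell--Lorentz finite difference scheme of Joseph et al. (coupling the variables $B$, $E$, $D$) in the harmonic case (zero damping), with parameters $\epsilon_0,\mu_0,\epsilon_\infty,\omega_1,\delta t,\delta x>0$ and $\epsilon_s\ge\epsilon_\infty$, and let $c_\infty=1/\sqrt{\epsilon_0\epsilon_\infty\mu_0}$. The scheme is stable under the following condition: (i) if $\epsilon_s>\epsilon_\infty$: $\ \delta t\le\dfrac{\delta x}{\sqrt2\,c_\infty}$; (ii) if $\epsilon_s=\epsilon_\infty$: $\ \delta t<\sqrt{\dfrac{\delta x^2}{2c_\infty^2}-\dfrac{2}{\omega_1^2}}$, this condition being meaningful only if $\delta x>2c_\infty/\omega_1$ (which is assumed in (ii)).
   Context: The scheme is, for $j,n$ integers, $$\tfrac1{\delta t}(B_{j+1/2}^{n+1/2}-B_{j+1/2}^{n-1/2})=-\tfrac1{\delta x}(E_{j+1}^n-E_j^n),\qquad \tfrac1{\delta t}(D_j^{n+1}-D_j^n)=-\tfrac1{\mu_0\delta x}(B_{j+1/2}^{n+1/2}-B_{j-1/2}^{n+1/2}),$$ $$\epsilon_0\epsilon_\infty\frac{E_j^{n+1}-2E_j^n+E_j^{n-1}}{\delta t^2}+\epsilon_0\epsilon_s\omega_1^2\frac{E_j^{n+1}+E_j^{n-1}}2=\frac{D_j^{n+1}-2D_j^n+D_j^{n-1}}{\delta t^2}+\omega_1^2\frac{D_j^{n+1}+D_j^{n-1}}2 .$$ Put $\lambda=c_\infty\delta t/\delta x$, $\omega=\omega_1^2\delta t^2/2$,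 $\epsilon_s'=\epsilon_s/\epsilon_\infty$ and, for $\xi\in\mathbb R$, $\sigma=\lambda(e^{i\xi}-1)$, $q=|\sigma|^2=4\lambda^2\sin^2(\xi/2)$; a star denotes complex conjugation. For plane waves $U_j^n=U^n e^{i\xi j}$ in the variable $U_j^n=(c_\infty B_{j+1/2}^{n-1/2},E_j^n,E_j^{n-1},D_j^n/(\epsilon_0\epsilon_\infty))^t$ (the quantity $D_j^{n-1}$ being eliminated through the discrete Amp\`ere equation between times $n-1$ and $n$) the scheme reads $U^{n+1}=G(\xi)U^n$ with amplification matrix $$G(\xi)=\begin{pmatrix}1&-\sigma&0&0\\ 0&\frac{2-q(1+\omega)}{1+\omega\epsilon_s'}&-1&\frac{2\omega}{1+\omega\epsilon_s'}\\ 0&1&0&0\\ \sigma^*&-q&0&1\end{pmatrix}.$$ Stability (in the sense of von Neumann) means: for every $\xi\in\mathbb R$, the sequence of powers $(G(\xi)^n)_{n\ge0}$ is bounded. *)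

(* Defs.v *)
From HB Require Import structures.
From mathcomp Require Import all_boot all_order all_algebra.
From mathcomp Require Import complex.
From mathcomp Require Import all_classical all_reals all_analysis.
From mathcomp Require Import ring.
Set Implicit Arguments.
Unset Strict Implicit.
Unset Printing Implicit Defensive.
Import Order.TTheory GRing.Theory Num.Theory numFieldNormedType.Exports.
Local Open Scope classical_set_scope.
Local Open Scope ring_scope.
Local Open Scope complex_scope.

Record lorentz_params (R : realType) := LorentzParams {
  eps0 : R; mu0 : R; eps_inf : R; eps_s : R; omega1 : R; dt : R; dx : R }.

(* Grid functions are indexed by space first, then time.  Half-integer indices
   are rounded down: [B j n] is the magnetic field at (j+1/2, n+1/2). *)
Definition lorentz_scheme (R : realType) (p : lorentz_params R)
    (B E D : int -> int -> R[i]) : Prop :=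
  forall j n : int,
  [/\ ((dt p)^-1)%:C * (B j n - B j (n - 1))
        = - ((dx p)^-1)%:C * (E (j + 1) n - E j n),
      ((dt p)^-1)%:C * (D j (n + 1) - D j n)
        = - ((mu0 p * dx p)^-1)%:C * (B j n - B (j - 1) n)
    & (eps0 p * eps_inf p)%:C
          * ((E j (n + 1) - 2 * E j n + E j (n - 1)) / (dt p ^+ 2)%:C)
        + (eps0 p * eps_s p * omega1 p ^+ 2)%:C
          * ((E j (n + 1) + E j (n - 1)) / 2)
      = (D j (n + 1) - 2 * D j n + D j (n - 1)) / (dt p ^+ 2)%:C
        + (omega1 p ^+ 2)%:C * ((D j (n + 1) + D j (n - 1)) / 2)].

Definition c_inf (R : realType) (p : lorentz_params R) : R :=
  (Num.sqrt (eps0 p * eps_inf p * mu0 p))^-1.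

Definition courant (R : realType) (p : lorentz_params R) : R :=
  c_inf p * dt p / dx p.

Definition omega_red (R : realType) (p : lorentz_params R) : R :=
  omega1 p ^+ 2 * dt p ^+ 2 / 2.

Definition eps_s_red (R : realType) (p : lorentz_params R) : R :=
  eps_s p / eps_inf p.

Definition expi (R : realType) (x : R) : R[i] := cos x +i* sin x.

Definition lorentz_sigma (R : realType) (p : lorentz_params R) (xi : R) :
    R[i] :=
  (courant p)%:C * (expi xi - 1).

(* Acts on [state_vector] below; see [plane_waveP] for its derivation from the
   scheme. *)
Definition amplification_matrix (R : realType) (p : lorentz_params R)
    (xi : R) : 'M[R[i]]_4 :=
  let s := lorentz_sigma p xi in
  let q := `|s| ^+ 2 in
  let w := (omega_red p)%:C in
  let e := (eps_s_red p)%:C in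
  \matrix_(i < 4, j < 4) nth 0 (nth [::]
    [:: [:: 1;          - s;                             0;   0];
        [:: 0;          (2 - q * (1 + w)) / (1 + w * e); - 1; 2 * w / (1 + w * e)];
        [:: 0;          1;                               0;   0];
        [:: Num.conj s; - q;                             0;   1]] i) j.

(* The norm of a matrix is here the largest modulus of its entries. *)
Definition von_neumann_stable (R : realType) (p : lorentz_params R) : Prop :=
  forall xi : R,
    bounded_set (range (fun n : nat => amplification_matrix p xi ^+ n)).

Definition plane_wave (R : realType) (xi : R) (u : int -> R[i]) :
    int -> int -> R[i] :=
  fun j n => u n * expi (xi * j%:~R).

Definition state_vector (R : realType) (p : lorentz_params R)
    (b e d : int -> R[i]) (n : int) : 'cV[R[i]]_4 :=
  \col_(i < 4) nth 0 [:: (c_inf p)%:C * b (n - 1); e n; e (n - 1);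
                         d n / (eps0 p * eps_inf p)%:C] i.

Lemma expiD (R : realType) (x y : R) : expi (x + y) = expi x * expi y.
Proof. by apply/eqP; rewrite eq_complex /= cosD sinD !eqxx /= addrC eqxx. Qed.

Lemma expiN (R : realType) (x : R) : expi (- x) = Num.conj (expi x).
Proof. by rewrite /expi cosN sinN. Qed.

Lemma expi_conjM (R : realType) (x : R) : expi x * Num.conj (expi x) = 1.
Proof.
rewrite -expiN -expiD subrr /expi cos0 sin0; by [].
Qed.

Lemma sqr_lorentz_sigma (R : realType) (p : lorentz_params R) (xi : R) :
  `|lorentz_sigma p xi| ^+ 2 = (4 * courant p ^+ 2 * sin (xi / 2) ^+ 2)%:C.
Proof.
rewrite normCK /lorentz_sigma.
have {1 2}-> : xi = xi / 2 + xi / 2 by rewrite -splitr.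
rewrite expiD /expi.
have := cos2Dsin2 (xi / 2); set c := cos _; set s := sin _ => h.
set l := courant p.
have hc : c * c = 1 - s * s by rewrite -h; ring.
apply/eqP; rewrite eq_complex /=; apply/andP; split; apply/eqP; last by ring.
transitivity (l ^+ 2 * ((c * c - s * s - 1) ^+ 2 + 4 * (s * s) * (c * c))).
  by ring.
by rewrite hc; ring.
Qed.

Lemma eq_scaled (F : fieldType) (k a b a' b' : F) :
  k != 0 -> a - b = k * (a' - b') -> a = b <-> a' = b'.
Proof.
move=> k0 h; split=> ab; apply/eqP.
  by rewrite -subr_eq0 -(mulrI_eq0 _ (mulfI k0)) -h ab subrr.
by rewrite -subr_eq0 h ab subrr mulr0.
Qed.

Lemma faraday_modeP (F : fieldType) (t x c z f b0 b1 e1 : F) :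
  t != 0 -> x != 0 -> c != 0 -> f != 0 ->
  t^-1 * (b1 * f - b0 * f) = - x^-1 * (e1 * (f * z) - e1 * f) <->
  c * b1 = c * b0 - c * t / x * (z - 1) * e1.
Proof.
move=> t0 x0 c0 f0; apply: (@eq_scaled _ (f / (t * c))).
  by rewrite !mulf_neq0 ?invr_neq0 ?mulf_neq0.
by field; rewrite t0 x0 c0.
Qed.

Lemma ampere_modeP (F : fieldType) (t x c k m y f b1 d0 d1 : F) :
  t != 0 -> x != 0 -> k != 0 -> m != 0 -> f != 0 -> c ^+ 2 * (k * m) = 1 ->
  t^-1 * (d1 * f - d0 * f) = - (m * x)^-1 * (b1 * f - b1 * (f * y)) <->
  d1 / k = d0 / k + c * t / x * (y - 1) * (c * b1).
Proof.
move=> t0 x0 k0 m0 f0 hc; apply: (@eq_scaled _ (f * k / t)).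
  by rewrite !mulf_neq0 ?invr_neq0.
have -> : c * t / x * (y - 1) * (c * b1) = (k * m)^-1 * (t / x * (y - 1) * b1).
  rewrite -[(k * m)^-1]mul1r -hc mulfK ?mulf_neq0 //; ring.
by field; rewrite t0 x0 k0 m0.
Qed.

Lemma lorentz_modeP (F : fieldType) (t k0 ki ks w f e0 e1 e2 d0 d1 d2 : F) :
  t != 0 -> k0 != 0 -> ki != 0 -> f != 0 -> (2 : F) != 0 ->
  k0 * ki * ((e2 * f - 2 * (e1 * f) + e0 * f) / t ^+ 2)
    + k0 * ks * w ^+ 2 * ((e2 * f + e0 * f) / 2)
  = (d2 * f - 2 * (d1 * f) + d0 * f) / t ^+ 2 + w ^+ 2 * ((d2 * f + d0 * f) / 2)
  <->
  (1 + w ^+ 2 * t ^+ 2 / 2 * (ks / ki)) * (e2 + e0) = 2 * e1 +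
   (d2 / (k0 * ki) - 2 * (d1 / (k0 * ki)) + d0 / (k0 * ki))
   + w ^+ 2 * t ^+ 2 / 2 * (d2 / (k0 * ki) + d0 / (k0 * ki)).
Proof.
move=> t0 h0 hi f0 h2; apply: (@eq_scaled _ (f * (k0 * ki) / t ^+ 2)).
  by rewrite !mulf_neq0 ?invr_neq0 ?expf_neq0 ?mulf_neq0.
by field; rewrite t0 h0 hi h2.
Qed.

Lemma lorentz_row (F : fieldType) (w e s sc b e0 e1 e2 d0 d1 d2 : F) :
  1 + w * e != 0 ->
  d1 = d0 + sc * b -> d2 = d1 + sc * (b - s * e1) ->
  (1 + w * e) * (e2 + e0) = 2 * e1 + (d2 - 2 * d1 + d0) + w * (d2 + d0) <->
  e2 = (2 - s * sc * (1 + w)) / (1 + w * e) * e1 - e0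
       + 2 * w / (1 + w * e) * d1.
Proof.
move=> h0 h1 h2; have -> : d0 = d1 - sc * b by rewrite h1 addrK.
rewrite h2; apply: (@eq_scaled _ (1 + w * e)) => //.
by field.
Qed.

Lemma plane_waveP (R : realType) (p : lorentz_params R) (xi : R)
    (b e d : int -> R[i]) :
  0 < eps0 p -> 0 < mu0 p -> 0 < eps_inf p -> 0 < eps_s p -> 0 < omega1 p ->
  0 < dt p -> 0 < dx p ->
  lorentz_scheme p (plane_wave xi b) (plane_wave xi e) (plane_wave xi d) <->
  forall n : int, state_vector p b e d (n + 1) =
    amplification_matrix p xi *m state_vector p b e d n.
Proof.
move=> h0 hm hi hs hw ht hx.
have nz (r : R) : 0 < r -> r%:C != 0 by move=> r0; rewrite fmorph_eq0 gt_eqF.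
have hP : 0 < eps0 p * eps_inf p * mu0 p by rewrite !mulr_gt0.
have hc : 0 < c_inf p by rewrite invr_gt0 sqrtr_gt0.
have hcm : (c_inf p)%:C ^+ 2 * ((eps0 p * eps_inf p)%:C * (mu0 p)%:C) = 1.
  rewrite -!rmorphM -rmorphXn -rmorphM /= exprVn sqr_sqrtr ?ltW //.
  by rewrite mulVf ?gt_eqF.
have sE : lorentz_sigma p xi
    = (c_inf p)%:C * (dt p)%:C / (dx p)%:C * (expi xi - 1).
  by rewrite /lorentz_sigma /courant fmorph_div rmorphM.
have sE' : Num.conj (lorentz_sigma p xi)
    = (c_inf p)%:C * (dt p)%:C / (dx p)%:C * (expi (- xi) - 1).
  transitivity ((courant p)%:C * (expi (- xi) - 1)).
    apply/eqP; rewrite eq_complex /= cosN sinN.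
    by apply/andP; split; apply/eqP; ring.
  by rewrite /courant fmorph_div rmorphM.
have wE : (omega_red p)%:C = (omega1 p)%:C ^+ 2 * (dt p)%:C ^+ 2 / 2.
  by rewrite /omega_red fmorph_div rmorphM !rmorphXn rmorph_nat.
have eE : (eps_s_red p)%:C = (eps_s p)%:C / (eps_inf p)%:C by rewrite fmorph_div.
have kE : (eps0 p * eps_inf p)%:C = (eps0 p)%:C * (eps_inf p)%:C by exact: rmorphM.
have tI : ((dt p)^-1)%:C = (dt p)%:C^-1 by exact: fmorphV.
have xI : ((dx p)^-1)%:C = (dx p)%:C^-1 by exact: fmorphV.
have mxI : ((mu0 p * dx p)^-1)%:C = ((mu0 p)%:C * (dx p)%:C)^-1.
  by rewrite fmorphV rmorphM.
have t2 : (dt p ^+ 2)%:C = (dt p)%:C ^+ 2 by exact: rmorphXn.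
have w2 : (omega1 p ^+ 2)%:C = (omega1 p)%:C ^+ 2 by exact: rmorphXn.
have kswE : (eps0 p * eps_s p * omega1 p ^+ 2)%:C
    = (eps0 p)%:C * (eps_s p)%:C * (omega1 p)%:C ^+ 2.
  by rewrite !rmorphM.
have hwe : 1 + (omega_red p)%:C * (eps_s_red p)%:C != 0.
  rewrite -rmorphM -[1](rmorph1 (real_complex R)) -rmorphD; apply: nz.
  by rewrite addr_gt0 // mulr_gt0 // !divr_gt0 // mulr_gt0 // exprn_gt0.
have f0 (x : R) : expi x != 0.
  apply/eqP => ex; have /eqP := expi_conjM x.
  by rewrite ex mul0r eq_sym oner_eq0.
have n2 : (2 : R[i]) != 0 by rewrite pnatr_eq0.
have fS (j : int) : expi (xi * (j + 1)%:~R) = expi (xi * j%:~R) * expi xi.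
  by rewrite intrD mulrDr mulr1 expiD.
have fP (j : int) : expi (xi * (j - 1)%:~R) = expi (xi * j%:~R) * expi (- xi).
  by rewrite intrB mulrBr mulr1 expiD.
have faradayP j n := @faraday_modeP _ (dt p)%:C (dx p)%:C (c_inf p)%:C (expi xi)
  (expi (xi * j%:~R)) (b (n - 1)) (b n) (e n)
  (nz _ ht) (nz _ hx) (nz _ hc) (f0 _).
have ampereP j n := @ampere_modeP _ (dt p)%:C (dx p)%:C (c_inf p)%:C
  (eps0 p * eps_inf p)%:C (mu0 p)%:C (expi (- xi))
  (expi (xi * j%:~R)) (b n) (d n) (d (n + 1))
  (nz _ ht) (nz _ hx) (nz _ (mulr_gt0 h0 hi)) (nz _ hm) (f0 _) hcm.
have lorentzP j n := @lorentz_modeP _ (dt p)%:C (eps0 p)%:C (eps_inf p)%:C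
  (eps_s p)%:C (omega1 p)%:C (expi (xi * j%:~R)) (e (n - 1)) (e n) (e (n + 1))
  (d (n - 1)) (d n) (d (n + 1)) (nz _ ht) (nz _ h0) (nz _ hi) (f0 _) n2.
have rowP n := @lorentz_row _ (omega_red p)%:C (eps_s_red p)%:C
  (lorentz_sigma p xi) (Num.conj (lorentz_sigma p xi))
  ((c_inf p)%:C * b (n - 1)) (e (n - 1)) (e n) (e (n + 1))
  (d (n - 1) / (eps0 p * eps_inf p)%:C) (d n / (eps0 p * eps_inf p)%:C)
  (d (n + 1) / (eps0 p * eps_inf p)%:C) hwe.
have stepP (n : int) : state_vector p b e d (n + 1) =
    amplification_matrix p xi *m state_vector p b e d n <->
  [/\ (c_inf p)%:C * b n = (c_inf p)%:C * b (n - 1) - lorentz_sigma p xi * e n,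
      e (n + 1) = (2 - lorentz_sigma p xi * Num.conj (lorentz_sigma p xi)
          * (1 + (omega_red p)%:C))
          / (1 + (omega_red p)%:C * (eps_s_red p)%:C) * e n - e (n - 1)
        + 2 * (omega_red p)%:C / (1 + (omega_red p)%:C * (eps_s_red p)%:C)
          * (d n / (eps0 p * eps_inf p)%:C)
    & d (n + 1) / (eps0 p * eps_inf p)%:C = d n / (eps0 p * eps_inf p)%:C
        + Num.conj (lorentz_sigma p xi)
          * ((c_inf p)%:C * b (n - 1) - lorentz_sigma p xi * e n)].
  split=> [/colP H | [H0 H1 H2]].
    have := H (inord 0); have := H (inord 1); have := H (inord 3).
    rewrite !mxE !big_ord_recl !big_ord0 !mxE !inordK //= addrK -normCK.
    rewrite !(mul0r, mul1r, mulN1r, mulNr, addr0, add0r) addrA => -> -> ->.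
    by split=> //; rewrite normCK; ring.
  apply/colP => i; rewrite !mxE !big_ord_recl !big_ord0 !mxE /=.
  case: i => [[|[|[|[|//]]]] hi4] /=;
    rewrite ?addrK !(mul0r, mul1r, mulN1r, mulNr, addr0, add0r) ?normCK //.
    by rewrite H1 addrA.
  by rewrite H2; ring.
pose mode n :=
  [/\ (c_inf p)%:C * b n = (c_inf p)%:C * b (n - 1) - lorentz_sigma p xi * e n,
      d (n + 1) / (eps0 p * eps_inf p)%:C = d n / (eps0 p * eps_inf p)%:C
        + Num.conj (lorentz_sigma p xi) * ((c_inf p)%:C * b n)
    & (1 + (omega_red p)%:C * (eps_s_red p)%:C) * (e (n + 1) + e (n - 1))
      = 2 * e n + (d (n + 1) / (eps0 p * eps_inf p)%:C
          - 2 * (d n / (eps0 p * eps_inf p)%:C)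
          + d (n - 1) / (eps0 p * eps_inf p)%:C)
        + (omega_red p)%:C * (d (n + 1) / (eps0 p * eps_inf p)%:C
          + d (n - 1) / (eps0 p * eps_inf p)%:C)].
have schemeP : lorentz_scheme p (plane_wave xi b) (plane_wave xi e)
      (plane_wave xi d) <-> forall n : int, mode n.
  have eqs (j n : int) :
    [/\ ((dt p)^-1)%:C * (plane_wave xi b j n - plane_wave xi b j (n - 1))
          = - ((dx p)^-1)%:C * (plane_wave xi e (j + 1) n - plane_wave xi e j n),
        ((dt p)^-1)%:C * (plane_wave xi d j (n + 1) - plane_wave xi d j n)
          = - ((mu0 p * dx p)^-1)%:C
            * (plane_wave xi b j n - plane_wave xi b (j - 1) n)
      & (eps0 p * eps_inf p)%:C
          * ((plane_wave xi e j (n + 1) - 2 * plane_wave xi e j n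
              + plane_wave xi e j (n - 1)) / (dt p ^+ 2)%:C)
        + (eps0 p * eps_s p * omega1 p ^+ 2)%:C
          * ((plane_wave xi e j (n + 1) + plane_wave xi e j (n - 1)) / 2)
      = (plane_wave xi d j (n + 1) - 2 * plane_wave xi d j n
          + plane_wave xi d j (n - 1)) / (dt p ^+ 2)%:C
        + (omega1 p ^+ 2)%:C
          * ((plane_wave xi d j (n + 1) + plane_wave xi d j (n - 1)) / 2)] <->
    mode n.
    have [fa fb] := faradayP j n; have [aa ab] := ampereP j n.
    have [la lb] := lorentzP j n.
    rewrite /mode sE' sE wE eE /plane_wave fS fP tI xI mxI t2 w2 kswE kE.
    rewrite kE in aa ab.
    split=> -[H1 H2 H3].
      by split; [exact: fa | exact: aa | exact: la].
    by split; [exact: fb | exact: ab | exact: lb].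
  split=> H; first by move=> n; apply/(eqs 0).
  by move=> j n; apply/eqs.
rewrite schemeP; split=> [H n | H n].
  have [H1 H2 H3] := H n; have [_ H4 _] := H (n - 1).
  rewrite subrK in H4; rewrite H1 in H2.
  by apply/stepP; split=> //; apply/(rowP n H4 H2).
have /stepP[H1 H2 H3] := H n; have /stepP[H1' _ H4] := H (n - 1).
rewrite subrK -H1' in H4.
by split=> //; [rewrite H1 | apply/(rowP n H4 H3)].
Qed.

(* Main.v *)
Require Import Defs.
From mathcomp Require Import all_boot all_order all_algebra.
From mathcomp Require Import all_classical all_reals all_analysis.
From mathcomp Require Import complex ring lra.
Set Implicit Arguments.
Unset Strict Implicit.
Unset Printing Implicit Defensive.
Import Order.TTheory GRing.Theory Num.Theory.
Local Open Scope ring_scope.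

(** The powers of a diagonalizable matrix with spectrum in the closed unit disc
are bounded, so it suffices to diagonalize [G(xi)] at each frequency.  With
[a = 1 + omega eps_s'] and [y = z + 1/z], the characteristic equation becomes
the real quadratic [(a y - 2) (y - 2) + q ((1 + omega) y - 2) = 0].  For [q > 0]
it is positive at [y = -2] and [y = 2]; if it is negative at some [m] in
between, it has two distinct roots in [(-2, 2)], which yield four distinct
eigenvalues [z] on the unit circle.  When [eps_s' > 1] one takes [m = 2 / a].
When [eps_s' = 1] the quadratic factors with roots [2 / a] and [2 - q], and the
strict condition says exactly that [q] stays below the value at which they
collide; [m] is then their midpoint.  For [q = 0] the eigenvalue [1] is double
but semisimple. *)

(* Splitting [1] along the eigenspaces as [\sum_i C_i], with [C_i A = r_i C_i],
   gives [A ^+ k = \sum_i r_i ^+ k *: C_i]. *)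
Lemma pow_bounded_diagonalizable (K : numFieldType) (n : nat)
    (A : 'M[K]_n.+1) :
  diagonalizable A -> (forall r, eigenvalue A r -> `|r| <= 1) ->
  bounded_set (range (fun k : nat => A ^+ k)).
Proof.
move=> /diagonalizablePeigen[rs _ rsP] r1.
rewrite (big_nth 0) big_mkord in rsP.
have /sub_sumsmxP[u uE] : (1%:M <= \sum_(i < size rs) eigenspace A rs`_i)%MS.
  by rewrite rsP.
pose C i := u i *m eigenspace A rs`_i.
have CA i : C i *m A = rs`_i *: C i by apply/eigenspaceP; exact: submxMl.
have CX i k : C i *m A ^+ k = rs`_i ^+ k *: C i.
  elim: k => [|k IHk]; first by rewrite !expr0 mulmx1 scale1r.
  by rewrite !exprS -mulmxE mulmxA CA -scalemxAl IHk scalerA.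
exists (\sum_(i < size rs) `|C i|); split.
  by rewrite ger0_real // sumr_ge0.
move=> M ltM _ [k _ <-]; apply: le_trans (ltW ltM).
rewrite -[A ^+ k]mul1mx uE mulmx_suml.
apply: le_trans (ler_norm_sum _ _ _) _; apply: ler_sum => i _.
rewrite CX normrZ normrX.
have [C0|C0] := eqVneq (C i) 0; first by rewrite C0 normr0 mulr0.
rewrite ler_piMl // exprn_ile1 // r1 // /eigenvalue.
by apply: contraNneq C0 => e0; rewrite /C e0 mulmx0.
Qed.

(** The minimal polynomial divides a product of distinct linear factors. Since [rs] may be shorter
    than the dimension, this covers a repeated semisimple eigenvalue. *)
Lemma pow_bounded_horner (K : numFieldType) (n : nat) (A : 'M[K]_n.+1)
    (rs : seq K) :
  uniq rs -> all (fun r => `|r| <= 1) rs ->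
  horner_mx A (\prod_(r <- rs) ('X - r%:P)) = 0 ->
  bounded_set (range (fun k : nat => A ^+ k)).
Proof.
move=> rs_uniq rs1 /mxminpoly_min rsA; apply: pow_bounded_diagonalizable.
  by apply/diagonalizableP; exists rs.
move=> r; rewrite eigenvalue_root_min => /(root_dvdp rsA).
by rewrite root_prod_XsubC => /(allP rs1).
Qed.

(** The list exhausts the roots of the characteristic polynomial, so Cayley-Hamilton supplies the
    annihilating product. *)
Lemma pow_bounded_eigenvalues (K : numFieldType) (n : nat) (A : 'M[K]_n.+1)
    (rs : seq K) :
  size rs = n.+1 -> uniq rs -> all (fun r => `|r| <= 1) rs ->
  all (eigenvalue A) rs -> bounded_set (range (fun k : nat => A ^+ k)).
Proof.
move=> rs_size rs_uniq rs1 rsA; apply: (pow_bounded_horner rs_uniq rs1).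
rewrite -(Cayley_Hamilton A) [char_poly A](all_roots_prod_XsubC (rs := rs)).
- by rewrite (monicP (char_poly_monic A)) scale1r.
- by rewrite size_char_poly rs_size.
- by apply: sub_all rsA => r; rewrite eigenvalue_root_char.
- by rewrite uniq_rootsE.
Qed.

(** * Spectral algebra of the amplification matrix *)

(** The shape of [G(xi)] with [s], [t] for sigma and its conjugate, and [s * t] for [q], so that the
    spectral identities become polynomial. *)
Definition mode_matrix (K : nzRingType) (g h s t : K) : 'M[K]_4 :=
  \matrix_(i < 4, j < 4) nth 0 (nth [::]
    [:: [:: 1; - s;      0;   0];
        [:: 0; g;        - 1; h];
        [:: 0; 1;        0;   0];
        [:: t; - (s * t); 0;   1]] i) j.

(** The hypothesis is the characteristic equation. An explicit left eigenvector satisfies three of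
    the four column equations identically; the second column is the hypothesis. As [z != 1], its
    third entry is nonzero. *)
Lemma eigenvalue_mode_matrix (K : fieldType) (g h s t z : K) :
  z != 1 -> (z ^+ 2 + 1 - g * z) * (z - 1) ^+ 2 + s * t * h * z ^+ 2 = 0 ->
  eigenvalue (mode_matrix g h s t) z.
Proof.
move=> z1 hz; apply/eigenvalueP.
exists (\row_(j < 4) nth 0 [:: t * h * z; z * (z - 1) ^+ 2;
                              - (z - 1) ^+ 2; h * z * (z - 1)] j).
  apply/rowP => j; rewrite !mxE !big_ord_recl big_ord0 !mxE /=.
  case: j => [[|[|[|[|//]]]] lt_j] /=; try ring.
  by rewrite addr0; apply/eqP; rewrite -subr_eq0 -oppr_eq0 -hz; apply/eqP; ring.
apply/eqP => /rowP /(_ (inord 2)); rewrite !mxE inordK //= => /eqP.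
by rewrite oppr_eq0 expf_eq0 /= subr_eq0 (negPf z1).
Qed.

(** At [s = t = 0] the first coordinate splits off with eigenvalue 1, and the remaining 3 by 3 block
    has this cubic as characteristic polynomial. *)
Lemma horner_mode_matrix0 (K : comNzRingType) (h z z' : K) :
  z * z' = 1 -> horner_mx (mode_matrix (z + z') h 0 0)
    (\prod_(r <- [:: 1; z; z']) ('X - r%:P)) = 0.
Proof.
move=> zz; rewrite !big_cons big_nil mulr1 !rmorphM !rmorphB /=.
rewrite !horner_mx_X !horner_mx_C -!mulmxE.
apply/matrixP => i j; rewrite !mxE !big_ord_recl big_ord0 !mxE.
rewrite !big_ord_recl !big_ord0 !mxE /=.
case: i => [[|[|[|[|//]]]] lt_i]; case: j => [[|[|[|[|//]]]] lt_j] /=.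
all: rewrite ?(mulr1n, mulr0n).
all: by ring: zz.
Qed.

(** * Eigenvalues on the unit circle from real roots in (-2, 2) *)

Section UnitCircle.
Variable R : realType.
Local Open Scope complex_scope.
Implicit Types x y : R.

(** For [-1 < x < 1], the conjugate solutions of [z + 1/z = 2 * x]. *)
Definition unit_pair x : seq R[i] :=
  [:: x +i* Num.sqrt (1 - x ^+ 2); x -i* Num.sqrt (1 - x ^+ 2)].

Lemma normC_eq1 (x s : R) : x ^+ 2 + s ^+ 2 = 1 -> `|x +i* s| = 1.
Proof. by move=> xs; rewrite normc_def /= xs sqrtr1. Qed.

Lemma sqr_sqrt1B x : -1 < x < 1 -> Num.sqrt (1 - x ^+ 2) ^+ 2 = 1 - x ^+ 2.
Proof.
by move=> /andP[x1 x2]; rewrite sqr_sqrtr //; nra.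
Qed.

Lemma unit_pair_le1 x : -1 < x < 1 -> all (fun r => `|r| <= 1) (unit_pair x).
Proof.
by move=> /sqr_sqrt1B h; rewrite /= !normC_eq1 ?sqrrN ?h ?lexx // addrC subrK.
Qed.

Lemma unit_pairE x z :
  -1 < x < 1 -> z \in unit_pair x -> z ^+ 2 + 1 = (2 * x)%:C * z.
Proof.
move=> /sqr_sqrt1B; rewrite /unit_pair; move: (Num.sqrt _) => s h.
by rewrite !inE => /orP[] /eqP ->; apply/eqP; rewrite eq_complex /=;
  apply/andP; split; apply/eqP; ring: h.
Qed.

Lemma mem_unit_pair x (z : R[i]) : -1 < x < 1 -> z \in unit_pair x ->
  complex.Re z = x /\ complex.Im z != 0.
Proof.
move=> /andP[x1 x2].
have s0 : Num.sqrt (1 - x ^+ 2) != 0 by rewrite gt_eqF // sqrtr_gt0; nra.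
by rewrite !inE => /orP[] /eqP -> /=; rewrite ?oppr_eq0.
Qed.

Lemma unit_pair_uniq x : -1 < x < 1 -> uniq (unit_pair x).
Proof.
move=> x1; rewrite /= inE andbT; apply/eqP => -[sE].
have /(mem_unit_pair x1)[_] : x +i* Num.sqrt (1 - x ^+ 2) \in unit_pair x.
  by rewrite inE eqxx.
by rewrite /= => /eqP; apply; lra.
Qed.

Lemma unit_pair_neq1 x z : -1 < x < 1 -> z \in unit_pair x -> z != 1.
Proof.
by move=> x1 /(mem_unit_pair x1)[_]; apply: contraNneq => ->.
Qed.

Lemma unit_pair_cat_uniq x y : -1 < x < 1 -> -1 < y < 1 -> x != y ->
  uniq (unit_pair x ++ unit_pair y).
Proof.
move=> x1 y1 xy; rewrite cat_uniq !unit_pair_uniq // andbT andTb.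
apply/hasPn => z /(mem_unit_pair y1)[zy _].
by apply: contra xy => /(mem_unit_pair x1)[<- _]; rewrite zy.
Qed.

Lemma quadratic_roots (b c m l u : R) : l < m < u ->
  0 < l ^+ 2 + b * l + c -> m ^+ 2 + b * m + c < 0 ->
  0 < u ^+ 2 + b * u + c ->
  exists y1 y2, [/\ l < y1 < m, m < y2 < u,
    y1 ^+ 2 + b * y1 + c = 0 & y2 ^+ 2 + b * y2 + c = 0].
Proof.
move=> /andP[lm mu] pl pm pu.
pose p : {poly R} := 'X ^+ 2 + b *: 'X + c%:P.
have pE x : p.[x] = x ^+ 2 + b * x + c by rewrite /p !hornerE.
have [|y2 /andP[my2 y2u]] := @poly_ivt _ p _ _ (ltW mu).
  by rewrite !pE !ltW.
(* On the left of [m] the sign goes from positive to negative, hence the opposite polynomial. *)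
have [|y1 /andP[ly1 y1m]] := @poly_ivt _ (- p) _ _ (ltW lm).
  by rewrite !hornerN !pE oppr_le0 oppr_ge0 !ltW.
rewrite rootN !rootE !pE => /eqP r1 /eqP r2; exists y1, y2.
split => //; rewrite !lt_neqAle ?my2 ?y2u ?ly1 ?y1m !andbT.
- by apply/andP; split; apply/eqP => e; move: r1 pl pm; rewrite -?e; lra.
- by apply/andP; split; apply/eqP => e; move: r2 pu pm; rewrite -?e; lra.
Qed.

Lemma mode_matrix_bounded0 (g h : R) : -2 < g < 2 ->
  bounded_set (range (fun k : nat => mode_matrix g%:C h%:C 0 0 ^+ k)).
Proof.
move=> g2; have x1 : -1 < g / 2 < 1 by move/andP: g2 => [*]; lra.
set x := g / 2 in x1; pose s := Num.sqrt (1 - x ^+ 2).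
apply: (@pow_bounded_horner _ _ _ (1 :: unit_pair x)).
- rewrite cons_uniq unit_pair_uniq // andbT.
  by apply/negP => /(unit_pair_neq1 x1); rewrite eqxx.
- by move=> /=; rewrite normr1 lexx; exact: unit_pair_le1 x1.
have -> : g%:C = (x +i* s) + (x -i* s).
  by apply/eqP; rewrite eq_complex /= subrr eqxx andbT /x -splitr.
apply: horner_mode_matrix0; apply/eqP; rewrite eq_complex /=.
by have := sqr_sqrt1B x1; rewrite -/s => h1;
  apply/andP; split; apply/eqP; ring: h1.
Qed.

(** The sign hypotheses are the values of [(y - g) * (y - 2) + q * h] at -2, [m] and 2. Each of the
    two roots [y] yields a pair of eigenvalues with [z + 1/z = y]. *)
Lemma mode_matrix_bounded (g h q m : R) (s t : R[i]) :
  s * t = q%:C -> -2 < m < 2 ->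
  0 < 4 * (2 + g) + q * h -> (m - g) * (m - 2) + q * h < 0 -> 0 < q * h ->
  bounded_set (range (fun k : nat => mode_matrix g%:C h%:C s t ^+ k)).
Proof.
move=> st m2 pN2 pm p2.
have [y1 [y2 [y1m y2m r1 r2]]] :
    exists y1 y2, [/\ -2 < y1 < m, m < y2 < 2,
      y1 ^+ 2 + (- (g + 2)) * y1 + (2 * g + q * h) = 0 &
      y2 ^+ 2 + (- (g + 2)) * y2 + (2 * g + q * h) = 0].
  by apply: quadratic_roots => //; lra.
have x1 : -1 < y1 / 2 < 1.
  by move/andP: m2 => [? ?]; move/andP: y1m => [? ?]; lra.
have x2 : -1 < y2 / 2 < 1.
  by move/andP: m2 => [? ?]; move/andP: y2m => [? ?]; lra.
have xx : y1 / 2 != y2 / 2.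
  by move/andP: y2m => [? ?]; move/andP: y1m => [? ?]; rewrite lt_eqF //; lra.
have eig y z : -1 < y / 2 < 1 ->
    y ^+ 2 + (- (g + 2)) * y + (2 * g + q * h) = 0 ->
    z \in unit_pair (y / 2) -> eigenvalue (mode_matrix g%:C h%:C s t) z.
  move=> y1' ry zy; apply: eigenvalue_mode_matrix.
    exact: unit_pair_neq1 y1' zy.
  have := unit_pairE y1' zy; rewrite [2 * _]mulrC divfK ?pnatr_eq0 // => zE.
  (* Dividing [z ^+ 2 + 1 = y * z] out of both factors turns the characteristic equation into
     [z ^+ 2] times the quadratic in [y]. *)
  have -> : (z - 1) ^+ 2 = (y%:C - 2) * z.
    transitivity (z ^+ 2 + 1 - 2 * z); first by ring.
    by rewrite zE; ring.
  rewrite zE st.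
  transitivity ((y ^+ 2 + (- (g + 2)) * y + (2 * g + q * h))%:C * z ^+ 2);
    last by rewrite ry mul0r.
  rewrite !rmorphD rmorphXn !rmorphM rmorphN rmorphD !rmorph_nat /=.
  ring.
apply: (@pow_bounded_eigenvalues _ _ _
  (unit_pair (y1 / 2) ++ unit_pair (y2 / 2))).
- by [].
- exact: unit_pair_cat_uniq.
- by rewrite all_cat !unit_pair_le1.
- by rewrite all_cat; apply/andP; split; apply/allP => z; apply: eig.
Qed.

End UnitCircle.

(** * Application to the Maxwell-Lorentz scheme *)

Section Scheme.
Variable R : realType.
Local Open Scope complex_scope.

Lemma amplification_matrixE (p : lorentz_params R) (xi : R) :
  let q := 4 * courant p ^+ 2 * sin (xi / 2) ^+ 2 in
  let w := omega_red p in let a := 1 + w * eps_s_red p in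
  amplification_matrix p xi =
  mode_matrix ((2 - q * (1 + w)) / a)%:C (2 * w / a)%:C
    (lorentz_sigma p xi) (Num.conj (lorentz_sigma p xi)).
Proof.
move=> q w a; apply/matrixP => i j.
rewrite [LHS]mxE [RHS]mxE -normCK sqr_lorentz_sigma -/q {}/a -/w.
move: q w (eps_s_red p) (lorentz_sigma p xi) => q w e s.
have aC : (1 + w * e)%:C = 1 + w%:C * e%:C.
  by rewrite rmorphD rmorphM rmorph1.
have gC : ((2 - q * (1 + w)) / (1 + w * e))%:C
    = (2 - q%:C * (1 + w%:C)) / (1 + w%:C * e%:C).
  by rewrite fmorph_div -aC rmorphB rmorphM rmorph_nat rmorphD rmorph1.
have hC : (2 * w / (1 + w * e))%:C = 2 * w%:C / (1 + w%:C * e%:C).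
  by rewrite fmorph_div -aC rmorphM rmorph_nat.
by rewrite gC hC.
Qed.

Lemma amplification_bounded (p : lorentz_params R) (xi m : R) :
  let q := 4 * courant p ^+ 2 * sin (xi / 2) ^+ 2 in
  let w := omega_red p in let e := eps_s_red p in
  0 < w -> 1 <= e -> q < 4 ->
  (0 < q -> -2 < m < 2 /\
    ((1 + w * e) * m - 2) * (m - 2) + q * ((1 + w) * m - 2) < 0) ->
  bounded_set (range (fun n : nat => amplification_matrix p xi ^+ n)).
Proof.
move=> q w e w0 e1 q4 hm.
rewrite amplification_matrixE /= -/q -/w -/e.
have qE : lorentz_sigma p xi * Num.conj (lorentz_sigma p xi) = q%:C.
  by rewrite -normCK sqr_lorentz_sigma.
have q0 : 0 <= q by rewrite mulr_ge0 ?sqr_ge0 // mulr_ge0 ?sqr_ge0 ?ler0n.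
have a1 : 1 < 1 + w * e by nra.
have a0 : 0 < 1 + w * e by lra.
have [q_eq0|q_neq0] := eqVneq q 0.
  have s0 : lorentz_sigma p xi = 0.
    by apply/eqP; rewrite -normr_eq0 -sqrf_eq0 sqr_lorentz_sigma -/q q_eq0.
  rewrite s0 conjC0; apply: mode_matrix_bounded0.
  rewrite q_eq0 mul0r subr0 ltr_pdivrMr // ltr_pdivlMr //.
  by apply/andP; split; lra.
have qgt0 : 0 < q by rewrite lt_neqAle eq_sym q_neq0.
have [m2 pm] := hm qgt0.
apply: (mode_matrix_bounded (q := q) (m := m)) => //.
(* Since [e >= 1], the numerator is at least [(4 - q) * (4 + 2 * w)]. *)
- rewrite (_ : _ + _ = (8 * (1 + w * e) + 8 - 4 * q - 2 * q * w) / (1 + w * e)).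
    by rewrite divr_gt0 //; nra.
  by field; rewrite gt_eqF.
- rewrite (_ : _ + _ = (((1 + w * e) * m - 2) * (m - 2)
      + q * ((1 + w) * m - 2)) / (1 + w * e)).
    by rewrite pmulr_llt0 // invr_gt0.
  by field; rewrite gt_eqF.
- by rewrite mulr_gt0 // divr_gt0 // mulr_gt0.
Qed.

End Scheme.

Theorem mainTheorem6 (R : realType) (p : lorentz_params R) :
  0 < eps0 p -> 0 < mu0 p -> 0 < eps_inf p -> 0 < omega1 p ->
  0 < dt p -> 0 < dx p -> eps_inf p <= eps_s p ->
  (eps_inf p < eps_s p ->
   dt p <= dx p / (Num.sqrt 2 * c_inf p) ->
   von_neumann_stable p)
  /\
  (eps_s p = eps_inf p ->
   2 * c_inf p / omega1 p < dx p ->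
   dt p < Num.sqrt (dx p ^+ 2 / (2 * c_inf p ^+ 2) - 2 / omega1 p ^+ 2) ->
   von_neumann_stable p).
Proof.
move=> e00 m00 ei0 o0 t0 x0 eis.
have c0 : 0 < c_inf p by rewrite invr_gt0 sqrtr_gt0 !mulr_gt0.
have w0 : 0 < omega_red p by rewrite divr_gt0 // mulr_gt0 // exprn_gt0.
have e1 : 1 <= eps_s_red p by rewrite ler_pdivlMr // mul1r.
have l0 : 0 < courant p by rewrite divr_gt0 // mulr_gt0.
have qle (xi : R) :
    4 * courant p ^+ 2 * sin (xi / 2) ^+ 2 <= 4 * courant p ^+ 2.
  by rewrite ler_piMr // mulr_ge0 ?sqr_ge0.
split=> [eis_lt | eisE _] ht xi.
- have e1' : 1 < eps_s_red p by rewrite ltr_pdivlMr // mul1r.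
  (* The time step condition, squared; it gives [q <= 2]. *)
  have l2 : 2 * courant p ^+ 2 <= 1.
    have s0 : 0 < Num.sqrt 2 :> R by rewrite sqrtr_gt0.
    have le1 : Num.sqrt 2 * courant p <= 1.
      rewrite ler_pdivlMr ?mulr_gt0 // in ht.
      by rewrite /courant mulrA ler_pdivrMr // mul1r mulrA mulrC.
    rewrite -(sqr_sqrtr (ler0n R 2)) -exprMn.
    by rewrite exprn_ile1 // ltW // mulr_gt0.
  pose m := 2 / (1 + omega_red p * eps_s_red p).
  apply: (@amplification_bounded _ _ _ m) => //.
    by have := qle xi; lra.
  move=> q0; have a1 : 1 < 1 + omega_red p * eps_s_red p by nra.
  have a0 : 0 < 1 + omega_red p * eps_s_red p by lra.
  split.
    rewrite /m ltr_pdivrMr // ltr_pdivlMr //.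
    by apply/andP; split; lra.
  (* The choice of [m] kills the first product; the rest is negative because [eps_s_red p > 1] makes
     the denominator of [m] exceed [1 + omega_red p]. *)
  rewrite {1}/m mulrCA divff ?gt_eqF // mulr1 subrr mul0r add0r pmulr_rlt0 //.
  rewrite subr_lt0 /m mulrA ltr_pdivrMr //.
  by nra.
have eE : eps_s_red p = 1 by rewrite /eps_s_red eisE divff ?gt_eqF.
set w := omega_red p in w0.
(* This is the squared time step condition multiplied by the constant of [k0]; it bounds the largest
   [q] by [2 - 2 / (1 + w)]. *)
have lw : 4 * courant p ^+ 2 * (1 + w) < 2 * w.
  have : dt p ^+ 2 < dx p ^+ 2 / (2 * c_inf p ^+ 2) - 2 / omega1 p ^+ 2.
    (* [Num.sqrt] vanishes on negative arguments, so a root above [dt p > 0] has a positive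
       radicand. *)
    have X0 : 0 < dx p ^+ 2 / (2 * c_inf p ^+ 2) - 2 / omega1 p ^+ 2.
      by rewrite -sqrtr_gt0 (lt_trans t0).
    by rewrite -(sqr_sqrtr (ltW X0)) ltr_pXn2r ?nnegrE ?sqrtr_ge0 ?(ltW t0).
  have k0 : 0 < 2 * c_inf p ^+ 2 * omega1 p ^+ 2 * dt p ^+ 2 / dx p ^+ 2.
    by rewrite divr_gt0 ?mulr_gt0 ?exprn_gt0.
  rewrite -(ltr_pM2l k0) -subr_gt0 => hk.
  rewrite -subr_gt0; move: hk; congr (0 < _).
  by rewrite /w /omega_red /courant; field; rewrite !gt_eqF.
have L0 : 0 <= 4 * courant p ^+ 2 by rewrite mulr_ge0 ?sqr_ge0.
pose u := 2 / (1 + w).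
have uE : (1 + w) * u = 2 by rewrite mulrC divfK // gt_eqF //; lra.
have u0 : 0 < u by rewrite divr_gt0 //; lra.
set q := 4 * courant p ^+ 2 * sin (xi / 2) ^+ 2.
have qL : q <= 4 * courant p ^+ 2 := qle xi.
have qu : q < 2 - u by nra.
apply: (@amplification_bounded _ _ _ ((u + 2 - q) / 2)) => //.
  by rewrite -/q; lra.
rewrite -/q -/w eE mulr1 => q0; split; first by apply/andP; split; lra.
(* The quadratic is [(1 + w) * (y - u) * (y - (2 - q))], evaluated here at the midpoint of its
   roots; [qu] keeps them distinct. *)
rewrite (_ : _ + _ = - ((1 + w) * ((2 - q - u) / 2) ^+ 2)).
  by rewrite oppr_lt0 mulr_gt0 ?exprn_gt0 //; lra.
by rewrite /u; field; rewrite gt_eqF //; lra.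
Qed.
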